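(* Let $n, m, p$ be integers with $1 \le p \le \min(n,m)$. Let $U$ be an $n$-qubit operator (a unitary on $(\mathbb{C}^2)^{\otimes n}$) and let $V$ be an $m$-qubit operator (a unitary on $(\mathbb{C}^2)^{\otimes m}$). Suppose that either (Z case) $U$ is Z-permeable in each of its last $p$ qubits and $V$ is Z-permeable in each of its first $p$ qubits, or (X case) $U$ is X-permeable in each of its last $p$ qubits and $V$ is X-permeable in each of its first $p$ qubits. Then $U$ and $V$ commute when they intersect only on these $p$ qubits, that is, as operators on $(\mathbb{C}^2)^{\otimes (n+m-p)}$, $$(U \otimes \mathbf{1}^{\otimes (m-p)})\,(\mathbf{1}^{\otimes (n-p)} \otimes V) = (\mathbf{1}^{\otimes (n-p)} \otimes V)\,(U \otimes \mathbf{1}^{\otimes (m-p)}).$$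
   Context: A $k$-qubit operator (quantum gate) is a unitary operator on $(\mathbb{C}^2)^{\otimes k}$; the tensor factors are the qubits, ordered from first to last. $\mathbf{1}$ denotes the identity on $\mathbb{C}^2$, and $\mathbf{1}^{\otimes r}$ the identity on $(\mathbb{C}^2)^{\otimes r}$ (with $r=0$ meaning that the factor is absent). Let $Z = \begin{pmatrix}1&0\\0&-1\end{pmatrix}$ and $X = \begin{pmatrix}0&1\\1&0\end{pmatrix}$ be the Pauli matrices, and let $Z_i$ (resp. $X_i$) denote the operator acting as $Z$ (resp. $X$) on qubit $i$ and as the identity on all other qubits. Definition (permeability). A quantum gate $U$ is called Z-permeable in qubit $i$ if $U Z_i = Z_i U$. It is called X-permeable in qubit $i$ if $U X_i = X_i U$. *)

(* Defs.v *)
(* R[i], for a realType R, is the field of complex numbers.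

   An operator on (C^2)^{\otimes k} is given by its matrix in the computational
   basis.  Qubits are numbered from 0, first to last; qubit 0 is the most
   significant bit of a basis index, as tensmx orders product indices
   lexicographically. *)
From mathcomp Require Import all_boot all_order all_algebra.
From mathcomp Require Import sesquilinear spectral.
From mathcomp Require Import complex mxtens.
From mathcomp Require Import reals.

Set Implicit Arguments.
Unset Strict Implicit.
Unset Printing Implicit Defensive.

Import Order.TTheory GRing.Theory Num.Theory.

Local Open Scope ring_scope.

Notation qop C k := 'M[C]_(2 ^ k)%N.

(* Transport along an equality between numbers of qubits; entries and their
   positions are unchanged. *)
Definition qcast (C : pzRingType) (a b : nat) (e : a = b) (A : qop C a) :
    qop C b :=
  castmx (congr1 (expn 2) e, congr1 (expn 2) e) A.

Definition qtens (C : pzRingType) (a b : nat) (A : qop C a) (B : qop C b) :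
    qop C (a + b) :=
  castmx (esym (expnD 2 a b), esym (expnD 2 a b)) (tensmx A B).

(* For r = 0 this is the 1 x 1 identity matrix, so the factor is absent. *)
Definition qid (C : pzRingType) (r : nat) : qop C r := 1%:M.

Definition pauliZ (C : pzRingType) : qop C 1 :=
  block_mx (1%:M : 'M_1) 0 0 (- 1%:M : 'M_1).

Definition pauliX (C : pzRingType) : qop C 1 :=
  block_mx (0 : 'M_1) 1%:M 1%:M (0 : 'M_1).

Lemma on_qubit_subproof (k : nat) (i : 'I_k) : (i + 1 + (k - i.+1) = k)%N.
Proof. by rewrite addn1 subnKC. Qed.

Definition on_qubit (C : pzRingType) (k : nat) (A : qop C 1) (i : 'I_k) :
    qop C k :=
  qcast (on_qubit_subproof i)
    (qtens (qtens (qid C i) A) (qid C (k - i.+1))).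

Definition Zpermeable (C : pzRingType) (k : nat) (U : qop C k) (i : 'I_k) :
    Prop :=
  U *m on_qubit (pauliZ C) i = on_qubit (pauliZ C) i *m U.

Definition Xpermeable (C : pzRingType) (k : nat) (U : qop C k) (i : 'I_k) :
    Prop :=
  U *m on_qubit (pauliX C) i = on_qubit (pauliX C) i *m U.

Definition on_first (C : pzRingType) (n m p : nat) (hpm : (p <= m)%N)
    (U : qop C n) : qop C (n + m - p) :=
  qcast (addnBA n hpm) (qtens U (qid C (m - p))).

Definition on_last (C : pzRingType) (n m p : nat) (hpn : (p <= n)%N)
    (V : qop C m) : qop C (n + m - p) :=
  qcast (addnBAC m hpn) (qtens (qid C (n - p)) V).

(* Main.v *)
(* Only V has to be taken apart. An operator commuting with A (= Z or X) on its
   first qubit is 1 (x) V0 + A (x) V1, since the commutant of A in the 2 x 2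
   matrices is spanned by 1 and A; moreover V0 and V1 commute with every B such
   that V commutes with 1 (x) B. By induction on p, it remains that U commutes
   with A on the first shared qubit, which is its permeability there. *)
Require Import Defs.
From mathcomp Require Import all_boot all_order all_algebra.
From mathcomp Require Import sesquilinear spectral.
From mathcomp Require Import complex mxtens.
From mathcomp Require Import reals.

Import Order.TTheory GRing.Theory Num.Theory.
Local Open Scope ring_scope.

(** * Transport along equalities of qubit counts *)

Section Cast.
Context {C : pzRingType}.

Lemma qcast_id {a} (e : a = a) (A : qop C a) : qcast e A = A.
Proof. exact: castmx_id. Qed.

Lemma qcast_irr {a b} (e e' : a = b) (A : qop C a) : qcast e A = qcast e' A.
Proof. by rewrite (nat_irrelevance e e'). Qed.

Lemma qcast_comp {a b c} (e : a = b) (e' : b = c) (A : qop C a) :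
  qcast e' (qcast e A) = qcast (etrans e e') A.
Proof. by case: c / e'; rewrite qcast_id. Qed.

Lemma qcastD {a b} (e : a = b) (A B : qop C a) :
  qcast e (A + B) = qcast e A + qcast e B.
Proof. by case: b / e; rewrite !qcast_id. Qed.

Lemma qcastM {a b} (e : a = b) (A B : qop C a) :
  qcast e (A *m B) = qcast e A *m qcast e B.
Proof. by case: b / e; rewrite !qcast_id. Qed.

Lemma qtens_castl {a a' b} (e : a = a') (A : qop C a) (B : qop C b) :
  qtens (qcast e A) B = qcast (congr1 (addn^~ b) e) (qtens A B).
Proof. by case: a' / e; rewrite !qcast_id. Qed.

End Cast.

(** * Tensor products of operators, entry by entry *)

Section Tensor.
Context {C : comPzRingType}.

(** The value is [i * 2 ^ b + j]: the bits of [i] followed by those of [j]. *)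
Definition qidx {a b} (i : 'I_(2 ^ a)%N) (j : 'I_(2 ^ b)%N) : 'I_(2 ^ (a + b))%N :=
  cast_ord (esym (expnD 2 a b)) (mxtens_index (i, j)).

Lemma qidx_surj {a b} (x : 'I_(2 ^ (a + b))%N) : exists i j, x = qidx i j.
Proof.
exists (mxtens_unindex (cast_ord (expnD 2 a b) x)).1.
exists (mxtens_unindex (cast_ord (expnD 2 a b) x)).2.
by rewrite /qidx -surjective_pairing mxtens_unindexK cast_ordK.
Qed.

Lemma qmatrixP {a b} (A B : qop C (a + b)) :
  (forall i j k l, A (qidx i j) (qidx k l) = B (qidx i j) (qidx k l)) -> A = B.
Proof.
move=> AB; apply/matrixP => x y.
by have [i [j ->]] := qidx_surj x; have [k [l ->]] := qidx_surj y.
Qed.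

Lemma qtensE {a b} (A : qop C a) (B : qop C b) i j k l :
  qtens A B (qidx i j) (qidx k l) = A i k * B j l.
Proof. by rewrite /qtens castmxE /= !esymK !cast_ordKV tensmxE. Qed.

Lemma qtensM {a b} (A A' : qop C a) (B B' : qop C b) :
  qtens A B *m qtens A' B' = qtens (A *m A') (B *m B').
Proof.
rewrite /qtens -tensmx_mul; move: (tensmx A B) (tensmx A' B') => M N.
by case: _ / (esym (expnD 2 a b)); rewrite !castmx_id.
Qed.

Lemma qidx_inj {a b} (i k : 'I_(2 ^ a)%N) (j l : 'I_(2 ^ b)%N) :
  (qidx i j == qidx k l) = (i == k) && (j == l).
Proof.
rewrite /qidx (inj_eq (@cast_ord_inj _ _ _)).
by rewrite (inj_eq (can_inj (@mxtens_indexK _ _))) xpair_eqE.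
Qed.

Lemma qtens_id a b : qtens (qid C a) (qid C b) = qid C (a + b).
Proof.
apply: qmatrixP => i j k l.
by rewrite qtensE !mxE qidx_inj -natrM mulnb.
Qed.

Lemma qtensDr {a b} (A : qop C a) (B B' : qop C b) :
  qtens A (B + B') = qtens A B + qtens A B'.
Proof. by apply: qmatrixP => i j k l; rewrite mxE !qtensE mxE mulrDr. Qed.

Lemma qtensDl {a b} (A A' : qop C a) (B : qop C b) :
  qtens (A + A') B = qtens A B + qtens A' B.
Proof. by apply: qmatrixP => i j k l; rewrite mxE !qtensE mxE mulrDl. Qed.

(** Concatenation of bit strings is associative: both values are
    [i * 2 ^ (b + c) + j * 2 ^ c + k]. *)
Lemma qidxA {a b c} (e : (2 ^ (a + b + c) = 2 ^ (a + (b + c)))%N)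
    (i : 'I_(2 ^ a)%N) (j : 'I_(2 ^ b)%N) (k : 'I_(2 ^ c)%N) :
  cast_ord e (qidx (qidx i j) k) = qidx i (qidx j k).
Proof. by apply: val_inj; rewrite /= mulnDl -mulnA -expnD addnA. Qed.

Lemma qtensA {a b c} (e : (a + (b + c) = a + b + c)%N)
    (A : qop C a) (B : qop C b) (D : qop C c) :
  qtens (qtens A B) D = qcast e (qtens A (qtens B D)).
Proof.
apply: qmatrixP => x k y l.
have [i [j ->]] := qidx_surj x; have [i' [j' ->]] := qidx_surj y.
by rewrite !qtensE /qcast castmxE /= !qidxA !qtensE mulrA.
Qed.

Lemma qtens_id0l {a} (A : qop C a) : qtens (qid C 0) A = A.
Proof.
have idx0 (i : 'I_(2 ^ 0)%N) (j : 'I_(2 ^ a)%N) : qidx i j = j.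
  by apply: val_inj; rewrite (ord1 i).
by apply: (@qmatrixP 0) => i j k l; rewrite qtensE !idx0 !ord1 mxE mul1r.
Qed.

(** Unlike [0 + a], the sum [a + 0] does not reduce to [a], hence the cast. *)
Lemma qtens_id0r {a} (e : (a = a + 0)%N) (A : qop C a) :
  qtens A (qid C 0) = qcast e A.
Proof.
apply: qmatrixP => i j k l.
rewrite qtensE castmxE !ord1 mxE mulr1.
by congr (A _ _); apply: val_inj; rewrite /= !expn0 muln1 addn0.
Qed.

End Tensor.

(** * Operators placed on consecutive qubits *)

Section Loc.
Context {C : comPzRingType}.

(** A common form for [on_qubit], [on_first] and [on_last]. The total [K] is tied to [l + k + r]
    only by an equation, so that placements with differently bracketed sums share one type. *)
Definition loc {l r k K} (e : (l + k + r = K)%N) (W : qop C k) : qop C K :=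
  qcast e (qtens (qtens (qid C l) W) (qid C r)).

Lemma loc_irr {l l' r r' k K} (e : (l + k + r = K)%N) (e' : (l' + k + r' = K)%N)
  (W : qop C k) : l = l' -> r = r' -> loc e W = loc e' W.
Proof. by move=> ll rr; subst l' r'; rewrite (nat_irrelevance e e'). Qed.

Lemma locD {l r k K} (e : (l + k + r = K)%N) (W W' : qop C k) :
  loc e (W + W') = loc e W + loc e W'.
Proof. by rewrite /loc qtensDr qtensDl qcastD. Qed.

Lemma locM {l r k K} (e : (l + k + r = K)%N) (W W' : qop C k) :
  loc e (W *m W') = loc e W *m loc e W'.
Proof. by rewrite /loc -qcastM !qtensM !mulmx1. Qed.

Lemma comm_loc {l r k K} (e : (l + k + r = K)%N) (W W' : qop C k) :
  comm_mx W W' -> comm_mx (loc e W) (loc e W').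
Proof. by rewrite /comm_mx -!locM => ->. Qed.

(** Offsets add up, since an identity on [l' + l] or [r + r'] qubits splits as a tensor product; the
    rest is reassociation. *)
Lemma loc_loc {l r k K l' r' K'} (e : (l + k + r = K)%N)
    (e' : (l' + K + r' = K')%N) (e'' : (l' + l + k + (r + r') = K')%N)
    (W : qop C k) :
  loc e' (loc e W) = loc e'' W.
Proof.
case: K / e in e' *; case: K' / e' in e'' *; rewrite /loc !qcast_id.
rewrite -!qtens_id (qtensA (addnA l' l k)) qtens_castl.
have assoc_r (D : qop C (l' + (l + k))) : qtens D (qtens (qid C r) (qid C r')) =
    qcast (esym (addnA _ r r')) (qtens (qtens D (qid C r)) (qid C r')).
  by rewrite (qtensA (addnA _ r r')) qcast_comp qcast_id.
rewrite assoc_r (qtensA (addnA l' (l + k) r)).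
by rewrite !qtens_castl !qcast_comp qcast_id.
Qed.

Lemma loc_0l {r k K} (e : (0 + k + r = K)%N) (W : qop C k) :
  loc e W = qcast e (qtens W (qid C r)).
Proof. by rewrite /loc qtens_id0l. Qed.

Lemma loc_0r {l k K} (e : (l + k + 0 = K)%N) (e' : (l + k = K)%N) (W : qop C k) :
  loc e W = qcast e' (qtens (qid C l) W).
Proof.
rewrite /loc (qtens_id0r (esym (addn0 _))) qcast_comp; exact: qcast_irr.
Qed.

Lemma loc_0l_id {r k} (e : (0 + k + r = k + r)%N) (W : qop C k) :
  loc e W = qtens W (qid C r).
Proof. by rewrite loc_0l; apply: qcast_id. Qed.

Lemma loc_0r_id {l k} (e : (l + k + 0 = l + k)%N) (W : qop C k) :
  loc e W = qtens (qid C l) W.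
Proof. by rewrite (loc_0r _ erefl) qcast_id. Qed.

End Loc.

(** * Block matrices with respect to the first qubit *)

Section FirstQubit.
Context {C : comPzRingType}.

(** The indices live in ['I_(1 + 1)], convertible to ['I_(2 ^ 1)], so that [lshift] and [rshift]
    name the two basis states as in [block_mx]. *)
Definition qblk {k} (s t : 'I_(1 + 1)) (V : qop C (1 + k)) : qop C k :=
  \matrix_(i, j) V (qidx (s : 'I_(2 ^ 1)%N) i) (qidx (t : 'I_(2 ^ 1)%N) j).

Lemma qblkP {k} (V W : qop C (1 + k)) :
  (forall s t, qblk s t V = qblk s t W) -> V = W.
Proof.
move=> VW; apply: qmatrixP => s i t j.
by have /matrixP/(_ i j) := VW s t; rewrite !mxE.
Qed.

Lemma qblkD {k} s t (V W : qop C (1 + k)) :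
  qblk s t (V + W) = qblk s t V + qblk s t W.
Proof. by apply/matrixP => i j; rewrite !mxE. Qed.

Lemma qblk_tens {k} s t (A : qop C 1) (B : qop C k) :
  qblk s t (qtens A B) = A s t *: B.
Proof. by apply/matrixP => i j; rewrite mxE qtensE mxE. Qed.

Lemma qblkM {k} s t (V W : qop C (1 + k)) :
  qblk s t (V *m W) =
  qblk s (lshift 1 0) V *m qblk (lshift 1 0) t W +
  qblk s (rshift 1 0) V *m qblk (rshift 1 0) t W.
Proof.
transitivity (\sum_u qblk s u V *m qblk u t W); last first.
  by rewrite big_split_ord !big_ord1.
apply/matrixP => i j; rewrite !mxE summxE.
under [RHS]eq_bigr => u _ do rewrite mxE.
rewrite pair_big /= (reindex (fun p : 'I_(1 + 1) * 'I_(2 ^ k)%N =>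
  qidx (p.1 : 'I_(2 ^ 1)%N) p.2)) /=.
  by apply: eq_bigr => p _; rewrite !mxE.
(* The reindexing is bijective because it is injective between sets of equal size. *)
apply: onW_bij; apply: inj_card_bij => [[u x] [v y] /= /eqP|].
  by rewrite qidx_inj => /andP[/eqP -> /eqP ->].
by rewrite card_prod !card_ord expnD.
Qed.

(** The only property of Z and X that the induction uses. Its last clause hands permeability in the
    remaining qubits of [V] down to [V0] and [V1]. *)
Definition splits_commutant (A : qop C 1) :=
  forall k (V : qop C (1 + k)), comm_mx V (qtens A (qid C k)) ->
  exists V0 V1, V = qtens (qid C 1) V0 + qtens A V1 /\
    forall B, comm_mx V (qtens (qid C 1) B) -> comm_mx V0 B /\ comm_mx V1 B.

(** The operator 1 (x) B is block diagonal with both blocks [B], so the [(s, t)] blocks of the two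
    products are the block of [V] times [B], and [B] times that block. *)
Lemma comm_qblk {k} s t (V : qop C (1 + k)) (B : qop C k) :
  comm_mx V (qtens (qid C 1) B) -> comm_mx (qblk s t V) B.
Proof.
move=> /(congr1 (qblk s t)); rewrite !qblkM !qblk_tens !mxE.
case: (split_ordP s) => i ->; case: (split_ordP t) => j ->; rewrite !ord1;
  rewrite ?eqxx ?eq_lrshift ?eq_rlshift /= !scale1r !scale0r;
  by rewrite ?mulmx0 ?mul0mx ?addr0 ?add0r.
Qed.

End FirstQubit.

(** * The commutants of Z and X *)

Section Pauli.
Context {C : numFieldType}.

Lemma pauliZE (s t : 'I_(1 + 1)) :
  pauliZ C s t = if s == t then (if s == lshift 1 0 then 1 else - 1) else 0.
Proof.
rewrite /pauliZ; case: (split_ordP s) => i ->; case: (split_ordP t) => j ->.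
- by rewrite [LHS]block_mxEul !ord1 !eqxx mxE.
- by rewrite [LHS]block_mxEur !ord1 eq_lrshift mxE.
- by rewrite [LHS]block_mxEdl !ord1 eq_rlshift mxE.
- by rewrite [LHS]block_mxEdr !ord1 !eqxx eq_rlshift !mxE.
Qed.

Lemma pauliXE (s t : 'I_(1 + 1)) : pauliX C s t = (s != t)%:R.
Proof.
rewrite /pauliX; case: (split_ordP s) => i ->; case: (split_ordP t) => j ->.
- by rewrite [LHS]block_mxEul !ord1 !eqxx mxE.
- by rewrite [LHS]block_mxEur !ord1 eq_lrshift mxE.
- by rewrite [LHS]block_mxEdl !ord1 eq_rlshift mxE.
- by rewrite [LHS]block_mxEdr !ord1 !eqxx !mxE.
Qed.

(** Commuting with Z makes each off-diagonal block its own opposite, hence zero. Half the sum and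
    half the difference of the diagonal blocks then serve as [V0] and [V1]. *)
Lemma splits_commutant_Z : splits_commutant (pauliZ C).
Proof.
move=> k V VZ; set s0 := lshift 1 (0 : 'I_1); set s1 := rshift 1 (0 : 'I_1).
exists (2^-1 *: (qblk s0 s0 V + qblk s1 s1 V)).
exists (2^-1 *: (qblk s0 s0 V - qblk s1 s1 V)).
have half2 (P Q : qop C k) : P = 2^-1 *: (P + Q) + 2^-1 *: (P - Q).
  rewrite -scalerDr addrACA subrr addr0 -mulr2n -scaler_nat scalerA.
  by rewrite mulVf ?scale1r // pnatr_eq0.
have eqN0 (P : qop C k) : (- P == P) = (P == 0).
  by rewrite -subr_eq0 -opprD oppr_eq0 -mulr2n -scaler_nat scaler_eq0 pnatr_eq0.
split; last first.
  move=> B VB; have bB s t : comm_mx B (qblk s t V).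
    exact/comm_mx_sym/comm_qblk.
  have BZ (W : qop C k) : comm_mx B W -> comm_mx (2^-1 *: W) B.
    by rewrite /comm_mx -scalemxAl -scalemxAr => ->.
  by split; apply: BZ; [apply: comm_mxD|apply: comm_mxB].
apply: qblkP => s t; have := congr1 (qblk s t) VZ.
rewrite !qblkM qblkD !qblk_tens.
case: (split_ordP s) => i ->; case: (split_ordP t) => j ->; rewrite !ord1.
all: rewrite !pauliZE !mxE ?eqxx ?eq_lrshift ?eq_rlshift /=.
all: rewrite -!scalemxAr -!scalemxAl !mulmx1 !mul1mx.
all: rewrite ?scale1r ?scale0r ?scaleN1r ?addr0 ?add0r.
- by rewrite -half2.
- by move/eqP; rewrite eqN0 => /eqP.
- by move/esym/eqP; rewrite eqN0 => /eqP.
- by rewrite -scalerN opprB [_ + qblk s1 s1 V]addrC -half2.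
Qed.

(** Commuting with X forces equal diagonal blocks and equal off-diagonal blocks, so the first row of
    blocks gives [V0] and [V1]. *)
Lemma splits_commutant_X : splits_commutant (pauliX C).
Proof.
move=> k V VX; set s0 := lshift 1 (0 : 'I_1); set s1 := rshift 1 (0 : 'I_1).
exists (qblk s0 s0 V), (qblk s0 s1 V).
split; last by move=> B VB; split; apply: comm_qblk.
have simplX : (pauliX C s0 s0 = 0) * (pauliX C s0 s1 = 1) *
    (pauliX C s1 s0 = 1) * (pauliX C s1 s1 = 0).
  by rewrite !pauliXE !eqxx eq_lrshift eq_rlshift.
have VXst s t := congr1 (qblk s t) VX.
(* Block [(s1, s0)] yields V11 = V00, and block [(s1, s1)] yields V10 = V01. *)
have := VXst s1 s1; have := VXst s1 s0.
rewrite !qblkM !qblk_tens -/s0 -/s1 !simplX !scale0r !scale1r.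
rewrite !mulmx0 !mul0mx !mulmx1 !mul1mx !addr0 !add0r => V11 V10.
apply: qblkP => s t; rewrite qblkD !qblk_tens.
case: (split_ordP s) => i ->; case: (split_ordP t) => j ->; rewrite !ord1.
all: rewrite -/s0 -/s1 !simplX !mxE ?eqxx ?eq_lrshift ?eq_rlshift /=.
all: by rewrite scale1r scale0r ?addr0 ?add0r.
Qed.

End Pauli.

(** Here [a] qubits belong to [U] alone, [p] are shared and [b] belong to [V] alone. The induction
    keeps [U] and [N] fixed and moves the first shared qubit into [a], while [V] loses it. *)
Lemma comm_shared {C : comPzRingType} {A : qop C 1} (hA : splits_commutant A) :
  forall p a b n m N (U : qop C n) (V : qop C m)
    (eU : (0 + n + b = N)%N) (eV : (a + m + 0 = N)%N),
  (a + p = n)%N -> (p + b = m)%N ->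
  (forall l r (e : (l + 1 + r = n)%N), (a <= l)%N -> comm_mx U (loc e A)) ->
  (forall l r (e : (l + 1 + r = m)%N), (l < p)%N -> comm_mx V (loc e A)) ->
  comm_mx (loc eU U) (loc eV V).
Proof.
elim=> [|p IHp] a b n m N U V eU eV en em UA VA.
  (* Without shared qubits both products are the tensor product of [U] and [V]. *)
  have en' : a = n by rewrite -en addn0.
  rewrite add0n in em; subst a b.
  rewrite loc_0l (loc_0r _ eU) /comm_mx -!qcastM !qtensM.
  by rewrite !mulmx1 !mul1mx.
subst m; change (p.+1 + b)%N with (1 + (p + b))%N in V, eV, VA.
have := VA 0 (p + b)%N erefl (ltn0Sn p).
rewrite (loc_0l_id (k:=1)) => /hA[V0 [V1 [defV commV]]].
(* Qubit [l] after the first one is qubit [1 + l] of [V], still among the [p.+1] shared ones. *)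
have VB l r (e : (l + 1 + r = p + b)%N) : (l < p)%N ->
    comm_mx V0 (loc e A) /\ comm_mx V1 (loc e A).
  move=> lp; apply: commV.
  have e1 : (1 + (p + b) + 0 = 1 + (p + b))%N by rewrite addn0.
  have e' : (1 + l + 1 + (r + 0) = 1 + (p + b))%N by rewrite -e addn0 !addnA.
  rewrite -(loc_0r_id e1) (loc_loc _ _ e').
  exact: VA.
have eA : (a + 1 + (p + b) = N)%N by rewrite -eV addn0 -addnA.
have eV' : (a + 1 + (p + b) + 0 = N)%N by rewrite addn0.
(* The first qubit of [V] is qubit [a] of the whole system, and A (x) V1 factors as (A (x) 1)(1 (x)
   V1). *)
have defLV : loc eV V = loc eV' V0 + loc eA A *m loc eV' V1.
  have eW : (1 + (p + b) + 0 = 1 + (p + b))%N by rewrite addn0.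
  have e0 : (0 + 1 + (p + b) = 1 + (p + b))%N by [].
  have -> : V = loc eW V0 + loc e0 A *m loc eW V1.
    rewrite (loc_0l_id (k:=1)) !(loc_0r_id (l:=1)) qtensM.
    by rewrite mulmx1 mul1mx.
  have eV2 : (a + 1 + (p + b) + (0 + 0) = N)%N by exact: eV'.
  have eA2 : (a + 0 + 1 + (p + b + 0) = N)%N by rewrite !addn0.
  rewrite locD locM !(loc_loc eW eV eV2) (loc_loc e0 eV eA2).
  by rewrite !(loc_irr eV2 eV') // (loc_irr eA2 eA) ?addn0.
rewrite defLV.
have IH W : (forall l r (e : (l + 1 + r = p + b)%N), (l < p)%N ->
      comm_mx W (loc e A)) -> comm_mx (loc eU U) (loc eV' W).
  move=> WA; apply: (IHp (a + 1)%N b) => //; first by rewrite -addnA add1n.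
  by move=> l r e al; apply: UA; apply: leq_trans al; rewrite leq_addr.
apply: comm_mxD; first by apply: IH => l r e lp; case: (VB l r e lp).
apply: comm_mxM; last by apply: IH => l r e lp; case: (VB l r e lp).
(* The remaining factor [A] sits on qubit [a], which lies inside [U]: permeability of [U] at the
   boundary case [l = a] applies. *)
have en' : (a + 1 + p = n)%N by rewrite -addnA add1n.
have eA' : (0 + a + 1 + (p + b) = N)%N by [].
have -> : loc eA A = loc eU (loc en' A).
  by rewrite (loc_loc _ _ eA'); apply: loc_irr.
exact/comm_loc/UA.
Qed.

Theorem theorem1 (R : realType) (n m p : nat)
    (hp : (1 <= p)%N) (hpn : (p <= n)%N) (hpm : (p <= m)%N)
    (U : qop R[i] n) (V : qop R[i] m)
    (hU : U \is unitarymx) (hV : V \is unitarymx)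
    (hperm :
      ((forall i : 'I_n, (n - p <= i)%N -> Zpermeable U i) /\
       (forall j : 'I_m, (j < p)%N -> Zpermeable V j))
      \/
      ((forall i : 'I_n, (n - p <= i)%N -> Xpermeable U i) /\
       (forall j : 'I_m, (j < p)%N -> Xpermeable V j))) :
  on_first hpm U *m on_last hpn V = on_last hpn V *m on_first hpm U.
Proof.
have eU : (0 + n + (m - p) = n + m - p)%N by rewrite add0n addnBA.
have eV : (n - p + m + 0 = n + m - p)%N by rewrite addn0 addnBAC.
have -> : on_first hpm U = loc eU U by rewrite loc_0l; apply: qcast_irr.
have -> : on_last hpn V = loc eV V by rewrite (loc_0r _ (addnBAC m hpn)).
(* The equation [e] forces [r = k - l.+1], so permeability stated for ordinals covers every such
   placement. *)
have on_qubitE k l r (e : (l + 1 + r = k)%N) (A : qop R[i] 1) :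
    exists2 i : 'I_k, val i = l & on_qubit A i = loc e A.
  have lk : (l < k)%N by rewrite -e addn1 leq_addr.
  exists (Ordinal lk) => //; apply: loc_irr => //=.
  by rewrite -e addn1 addKn.
have hA A (splitA : splits_commutant A)
    (UA : forall i : 'I_n, (n - p <= i)%N -> comm_mx U (on_qubit A i))
    (VA : forall j : 'I_m, (j < p)%N -> comm_mx V (on_qubit A j)) :
    comm_mx (loc eU U) (loc eV V).
  apply: (comm_shared splitA p (n - p) (m - p)); rewrite ?subnK ?subnKC //.
  - by move=> l r e lp; have [i il <-] := on_qubitE n l r e A;
    apply: UA; rewrite -il in lp.
  - by move=> l r e lp; have [i il <-] := on_qubitE m l r e A;
    apply: VA; rewrite -il in lp.
case: hperm => -[UA VA].
- exact: hA splits_commutant_Z UA VA.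
- exact: hA splits_commutant_X UA VA.
Qed.
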